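(* The Smale horseshoe $\Lambda$ is a computable (recursive) closed subset in $I=[0,1]\times[0,1]$.
   Context: Smale horseshoe: let $I=[0,1]^2$, and let $\mu>1$ and $0<\lambda<1$ be real numbers. The horseshoe map $f$ is defined over $I$, is a bijection onto its image in $\mathbb{R}^2$, and performs a linear vertical expansion of $I$ by the factor $\mu$ and a linear horizontal contraction of $I$ by the factor $\lambda$, followed by a folding. In the standard precise form: there are two disjoint horizontal strips $H_i=[0,1]\times[c_i,c_i+\mu^{-1}]\subset I$ ($i=1,2$) and two disjoint vertical strips $V_i=[d_i,d_i+\lambda]\times[0,1]\subset I$ ($i=1,2$), and $f:I\to\mathbb{R}^2$ is a continuous injective map such that $f(I)\cap I=V_1\cup V_2$, $f^{-1}(I)=H_1\cup H_2$, $f(H_i)=V_i$, with $f(x,y)=(d_1+\lambda x,\ \mu(y-c_1))$ on $H_1$ and $f(x,y)=(d_2+\lambda(1-x),\ 1-\mu(y-c_2))$ on $H_2$. The Smale horseshoe is the set $\Lambda=\bigcap_{j=-\infty}^{+\infty}f^j(I)$ (with all iterates intersected with $I$), i.e. the set of points $p\in I$ for which there is a bi-infinite sequence $(p_j)_{j\in\mathbb{Z}}$ in $I$ with $p_0=p$ and $f(p_j)=p_{j+1}$ for all $j\in\mathbb{Z}$. It is invariant: $f(\Lambda)=\Lambda$. Computability: a sequence of rational numbers is computable if it can be written as $(-1)^{a(k)}\frac{b(k)}{c(k)+1}$ with computable functions $a,b,c:\mathbb{N}\to\mathbb{N}$; a sequence in $\mathbb{Q}^n$ is computable if its component sequences are.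 An open set $E\subseteq\mathbb{R}^n$ is r.e. open if there are computable sequences $\{a_k\}$, $\{r_k\}$, $a_k\in\mathbb{Q}^n$, $r_k\in\mathbb{Q}$, such that $E=\bigcup_{k=0}^{\infty}B(a_k,r_k)$, where $B(a,r)=\{x\in\mathbb{R}^n:|x-a|<r\}$. A closed set $A\subseteq\mathbb{R}^n$ is r.e. closed if there is a computable sequence $\{b_k\}$, $b_k\in\mathbb{Q}^n$, such that $\{b_k\}$ is dense in $A$; it is co-r.e. closed if its complement $A^c$ is r.e. open; it is computable (or recursive) if it is both r.e. closed and co-r.e. closed. Here $n=2$.
   Formalization: The parameters λ, μ, c_i, d_i are assumed to be computable reals, and ''r.e. closed'' uses a computable dense sequence of real points of Λ; density of a computable sequence of rational points is proved when all six parameters are rational. *)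

(* Defs.v *)
From HB Require Import structures.
From mathcomp Require Import all_boot all_order all_algebra.
From mathcomp Require Import all_classical all_reals all_analysis.
Set Implicit Arguments.
Unset Strict Implicit.
Unset Printing Implicit Defensive.
Import Order.TTheory GRing.Theory Num.Theory.
Import numFieldNormedType.Exports.
Local Open Scope classical_set_scope.
Local Open Scope ring_scope.

(* Kleene's total recursive functions: minimization is only applied when a
   zero exists for every value of the parameters. *)
Inductive recursive : forall n : nat, (n.-tuple nat -> nat) -> Prop :=
| recursive_zero n : recursive (fun _ : n.-tuple nat => 0%N)
| recursive_succ : recursive (fun v : 1.-tuple nat => (thead v).+1)
| recursive_proj n (i : 'I_n) : recursive (fun v : n.-tuple nat => tnth v i)
| recursive_comp n m (f : m.-tuple nat -> nat)
    (g : 'I_m -> n.-tuple nat -> nat) :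
    recursive f -> (forall i, recursive (g i)) ->
    recursive (fun v : n.-tuple nat => f [tuple g i v | i < m])
| recursive_primrec n (f : n.-tuple nat -> nat) (g : n.+2.-tuple nat -> nat)
    (h : n.+1.-tuple nat -> nat) :
    recursive f -> recursive g ->
    (forall v : n.-tuple nat, h [tuple of 0%N :: v] = f v) ->
    (forall (k : nat) (v : n.-tuple nat),
       h [tuple of k.+1 :: v] = g [tuple of k :: h [tuple of k :: v] :: v]) ->
    recursive h
| recursive_min n (f : n.+1.-tuple nat -> nat) (h : n.-tuple nat -> nat) :
    recursive f ->
    (forall v : n.-tuple nat, f [tuple of h v :: v] = 0%N) ->
    (forall (v : n.-tuple nat) (k : nat),
       (k < h v)%N -> f [tuple of k :: v] <> 0%N) ->
    recursive h.

Definition computable1 (a : nat -> nat) : Prop :=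
  recursive (fun v : 1.-tuple nat => a (thead v)).

Definition computable2 (a : nat -> nat -> nat) : Prop :=
  recursive (fun v : 2.-tuple nat => a (tnth v ord0) (tnth v ord_max)).

Definition computable_ratseq (q : nat -> rat) : Prop :=
  exists a b c : nat -> nat,
    [/\ computable1 a, computable1 b, computable1 c &
      forall k, q k = (-1) ^+ a k * ((b k)%:R / (c k).+1%:R)].

Definition computable_ratseq2 (q : nat -> nat -> rat) : Prop :=
  exists a b c : nat -> nat -> nat,
    [/\ computable2 a, computable2 b, computable2 c &
      forall k m, q k m = (-1) ^+ a k m * ((b k m)%:R / (c k m).+1%:R)].

Section Computability.
Variable R : realType.

Definition computable_real (x : R) : Prop :=
  exists2 q : nat -> rat, computable_ratseq q &
    forall m, `|x - ratr (q m)| <= 2^-1 ^+ m.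

Definition computable_realseq (x : nat -> R) : Prop :=
  exists2 q : nat -> nat -> rat, computable_ratseq2 q &
    forall k m, `|x k - ratr (q k m)| <= 2^-1 ^+ m.

(* The library norm on R * R is the max norm, hence this Euclidean ball; it is
   empty when r <= 0. *)
Definition euclidean_ball (a : R * R) (r : R) : set (R * R) :=
  [set x | Num.sqrt ((x.1 - a.1) ^+ 2 + (x.2 - a.2) ^+ 2) < r].

Definition ratr2 (q : rat * rat) : R * R := (ratr q.1, ratr q.2).

Definition computable_ratseq_pair (b : nat -> rat * rat) : Prop :=
  computable_ratseq (fun k => (b k).1) /\ computable_ratseq (fun k => (b k).2).

Definition computable_realseq_pair (x : nat -> R * R) : Prop :=
  computable_realseq (fun k => (x k).1) /\
  computable_realseq (fun k => (x k).2).

Definition re_open (E : set (R * R)) : Prop :=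
  exists (a : nat -> rat * rat) (r : nat -> rat),
    [/\ computable_ratseq_pair a, computable_ratseq r &
      E = \bigcup_k euclidean_ball (ratr2 (a k)) (ratr (r k))].

Definition dense_seq_in (A : set (R * R)) (b : nat -> R * R) : Prop :=
  range b `<=` A /\ A `<=` closure (range b).

(* The points of the dense sequence are computable uniformly in the index, but
   need not be rational: already {(sqrt 2, 0)} has no rational point. *)
Definition re_closed (A : set (R * R)) : Prop :=
  closed A /\
  exists2 b : nat -> R * R, computable_realseq_pair b & dense_seq_in A b.

(* Stronger variant: the dense sequence consists of rational points of A. *)
Definition re_closed_rational (A : set (R * R)) : Prop :=
  closed A /\
  exists2 b : nat -> rat * rat, computable_ratseq_pair b &
    dense_seq_in A (fun k => ratr2 (b k)).

Definition co_re_closed (A : set (R * R)) : Prop :=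
  closed A /\ re_open (~` A).

Definition computable_closed (A : set (R * R)) : Prop :=
  re_closed A /\ co_re_closed A.

Definition computable_closed_rational (A : set (R * R)) : Prop :=
  re_closed_rational A /\ co_re_closed A.

End Computability.

Section Horseshoe.
Variable R : realType.

Definition unit_square : set (R * R) := `[0, 1]%classic `*` `[0, 1]%classic.

Definition horizontal_strip (mu c : R) : set (R * R) :=
  `[0, 1]%classic `*` `[c, c + mu^-1]%classic.

Definition vertical_strip (lambda d : R) : set (R * R) :=
  `[d, d + lambda]%classic `*` `[0, 1]%classic.

(* Values of f outside the unit square are irrelevant: f is total only for
   convenience. *)
Record horseshoe_map (lambda mu c1 c2 d1 d2 : R) (f : R * R -> R * R) : Prop :=
  HorseshoeMap {
    hs_mu : 1 < mu;
    hs_lambda : 0 < lambda < 1;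
    hs_H1 : horizontal_strip mu c1 `<=` unit_square;
    hs_H2 : horizontal_strip mu c2 `<=` unit_square;
    hs_H12 : horizontal_strip mu c1 `&` horizontal_strip mu c2 = set0;
    hs_V1 : vertical_strip lambda d1 `<=` unit_square;
    hs_V2 : vertical_strip lambda d2 `<=` unit_square;
    hs_V12 : vertical_strip lambda d1 `&` vertical_strip lambda d2 = set0;
    hs_continuous : {within unit_square, continuous f};
    hs_injective : set_inj unit_square f;
    hs_image : f @` unit_square `&` unit_square =
      vertical_strip lambda d1 `|` vertical_strip lambda d2;
    hs_preimage : unit_square `&` f @^-1` unit_square =
      horizontal_strip mu c1 `|` horizontal_strip mu c2;
    hs_fH1 : f @` horizontal_strip mu c1 = vertical_strip lambda d1;
    hs_fH2 : f @` horizontal_strip mu c2 = vertical_strip lambda d2;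
    hs_f1 : forall p, horizontal_strip mu c1 p ->
      f p = (d1 + lambda * p.1, mu * (p.2 - c1));
    hs_f2 : forall p, horizontal_strip mu c2 p ->
      f p = (d2 + lambda * (1 - p.1), 1 - mu * (p.2 - c2)) }.

Definition horseshoe (f : R * R -> R * R) : set (R * R) :=
  [set p | exists q : int -> R * R,
     [/\ forall j, unit_square (q j), q 0 = p &
       forall j, f (q j) = q (j + 1)]].

End Horseshoe.

(* Main.v *)
Require Import Defs.
From HB Require Import structures.
From mathcomp Require Import all_boot all_order all_algebra.
From mathcomp Require Import all_classical all_reals all_analysis.
From mathcomp Require Import zify ring lra.
Set Implicit Arguments.
Unset Strict Implicit.
Unset Printing Implicit Defensive.
Import Order.TTheory GRing.Theory Num.Theory.
Import numFieldNormedType.Exports.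
Local Open Scope classical_set_scope.
Local Open Scope ring_scope.

(* On the strips [H_b] the horseshoe map is [f (x, h_b y) = (g_b x, y)], where
   [g_0, g_1] and [h_0, h_1] are affine contractions of the unit interval: the
   past of an orbit determines [x] and its future determines [y].  Hence the
   horseshoe is the product of the attractors of these two iterated function
   systems.  Disjointness of the strips forces both ratios below [1/2], so the
   [2^n] images of the fixed point of [g_0] under words of length [n] are
   [2^-n]-dense in the attractor, and they are computable uniformly in the word
   and stable under perturbation of the parameters.  A rational ball whose
   radius is the distance from its centre to such a finite approximation, minus
   the precision, misses the attractor, and these balls exhaust the
   complement. *)

(** * Recursive functions *)

Lemma eq_recursive n (f g : n.-tuple nat -> nat) :
  f =1 g -> recursive f -> recursive g.
Proof. by move=> /funext ->. Qed.

Lemma recursive_const n c : recursive (fun _ : n.-tuple nat => c).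
Proof.
elim: c => [|c ih]; first exact: recursive_zero.
apply: (eq_recursive _ (recursive_comp (n := n) (g := fun _ _ => c)
  recursive_succ (fun=> ih))) => v.
by rewrite /thead tnth_mktuple.
Qed.

Lemma recursive_comp1 n (a : nat -> nat) (f : n.-tuple nat -> nat) :
  computable1 a -> recursive f -> recursive (fun v => a (f v)).
Proof.
move=> ra rf; apply: (eq_recursive _ (recursive_comp (g := fun _ => f) ra _)) => //.
by move=> v; rewrite /thead tnth_mktuple.
Qed.

Lemma recursive_comp2 n (a : nat -> nat -> nat) (f g : n.-tuple nat -> nat) :
  computable2 a -> recursive f -> recursive g ->
  recursive (fun v => a (f v) (g v)).
Proof.
move=> ra rf rg.
apply: (eq_recursive _ (recursive_comp
  (g := fun i => if i == ord0 then f else g) ra _)) => [v|i].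
  by rewrite !tnth_mktuple.
by case: ifP.
Qed.

(** A dummy first argument is added by composing with the projections [lift ord0 i]. *)
Lemma recursive_behead n (f : n.-tuple nat -> nat) :
  recursive f -> recursive (fun v : n.+1.-tuple nat => f (behead_tuple v)).
Proof.
move=> rf; apply: (eq_recursive _ (recursive_comp
  (g := fun i (v : n.+1.-tuple nat) => tnth v (lift ord0 i)) rf _)) => [v|i].
  by congr f; apply: eq_from_tnth => i; rewrite tnth_mktuple tnth_behead;
     congr tnth; apply: val_inj; rewrite /= inordK // ltnS ltn_ord.
exact: recursive_proj.
Qed.

Lemma recursive_thead n : recursive (fun v : n.+1.-tuple nat => thead v).
Proof. exact: recursive_proj. Qed.

Lemma recursive_cons n (N : n.-tuple nat -> nat) (h : n.+1.-tuple nat -> nat) :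
  recursive N -> recursive h -> recursive (fun v => h [tuple of N v :: v]).
Proof.
move=> rN rh; apply: (eq_recursive _ (recursive_comp
  (g := fun i v => tnth [tuple of N v :: v] i) rh _)) => [v|i].
  by congr h; apply: eq_from_tnth => i; rewrite tnth_mktuple.
case: (unliftP ord0 i) => [j|] ->.
  by apply: (eq_recursive _ (recursive_proj j)) => v; rewrite tnthS.
by apply: (eq_recursive _ rN) => v; rewrite tnth0.
Qed.

(** Primitive recursion in the form used below: the number of steps, the base value and the step all
    depend on the parameters [v]. The scheme [recursive_primrec] keeps the counter as first
    argument, so the recursion is carried out for a free counter, which is then replaced by
    [N v]. *)
Lemma recursive_nat_rect n (N F : n.-tuple nat -> nat)
    (G : nat -> nat -> n.-tuple nat -> nat) :
  recursive N -> recursive F ->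
  recursive (fun w : n.+2.-tuple nat => G (thead w) (thead (behead_tuple w))
    (behead_tuple (behead_tuple w))) ->
  recursive (fun v => nat_rect (fun=> nat) (F v) (fun k r => G k r v) (N v)).
Proof.
move=> rN rF rG.
pose h (w : n.+1.-tuple nat) := nat_rect (fun=> nat) (F (behead_tuple w))
  (fun k r => G k r (behead_tuple w)) (thead w).
have bK x (v : n.-tuple nat) : behead_tuple [tuple of x :: v] = v.
  exact: val_inj.
have rh : recursive h.
  apply: (recursive_primrec rF rG) => [v|k v].
    by rewrite /h bK.
  rewrite /h !bK !theadE /=; congr (G _ _ _).
  exact: val_inj.
by apply: (eq_recursive _ (recursive_cons rN rh)) => v; rewrite /h bK.
Qed.

Lemma recursive_S n (f : n.-tuple nat -> nat) :
  recursive f -> recursive (fun v => (f v).+1).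
Proof. exact: (recursive_comp1 recursive_succ). Qed.

Lemma recursive_add n (f g : n.-tuple nat -> nat) :
  recursive f -> recursive g -> recursive (fun v => f v + g v)%N.
Proof.
move=> rf rg.
apply: (eq_recursive _ (recursive_nat_rect (G := fun _ r _ => r.+1) rf rg _)).
  by move=> v; elim: (f v) => //= k ->.
exact/recursive_comp1/recursive_behead/recursive_thead/recursive_succ.
Qed.

Lemma recursive_pred n (f : n.-tuple nat -> nat) :
  recursive f -> recursive (fun v => (f v).-1).
Proof.
move=> rf.
apply: (eq_recursive _ (recursive_nat_rect (G := fun k _ _ => k) rf
  (recursive_const n 0) _)).
  by move=> v; case: (f v).
exact/recursive_thead.
Qed.

Lemma recursive_sub n (f g : n.-tuple nat -> nat) :
  recursive f -> recursive g -> recursive (fun v => f v - g v)%N.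
Proof.
move=> rf rg.
apply: (eq_recursive _ (recursive_nat_rect (G := fun _ r _ => r.-1) rg rf _)).
  by move=> v; elim: (g v) => [|k /= ->]; rewrite ?subn0 ?subnS.
exact/recursive_pred/recursive_behead/recursive_thead.
Qed.

Lemma recursive_mul n (f g : n.-tuple nat -> nat) :
  recursive f -> recursive g -> recursive (fun v => f v * g v)%N.
Proof.
move=> rf rg.
apply: (eq_recursive _ (recursive_nat_rect (G := fun _ r v => g v + r)%N rf
  (recursive_const n 0) _)).
  by move=> v; elim: (f v) => //= k ->; rewrite mulSn.
apply: recursive_add; last exact/recursive_behead/recursive_thead.
exact: (recursive_behead (recursive_behead rg)).
Qed.

Lemma recursive_if n (P : n.-tuple nat -> bool) (f g : n.-tuple nat -> nat) :
  recursive (fun v => P v : nat) -> recursive f -> recursive g -> recursive (fun v => if P v then f v else g v).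
Proof.
move=> rP rf rg; apply: (@eq_recursive _ (fun v => P v * f v + (1 - P v) * g v)%N).
  by move=> v; case: (P v); rewrite ?mul1n ?mul0n ?addn0.
apply: recursive_add; apply: recursive_mul => //; apply: recursive_sub => //.
exact: recursive_const.
Qed.

Lemma recursive_leq n (f g : n.-tuple nat -> nat) :
  recursive f -> recursive g -> recursive (fun v => f v <= g v : nat)%N.
Proof.
move=> rf rg; apply: (@eq_recursive _ (fun v => 1 - (f v - g v))%N).
  by move=> v; rewrite -subn_eq0; case: (f v - g v)%N.
exact/recursive_sub/recursive_sub/rg/rf/recursive_const.
Qed.

Lemma recursive_negb n (P : n.-tuple nat -> bool) :
  recursive (fun v => P v : nat) -> recursive (fun v => ~~ P v : nat).
Proof.
move=> rP; apply: (@eq_recursive _ (fun v => 1 - P v)%N).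
  by move=> v; case: (P v).
exact/recursive_sub/rP/recursive_const.
Qed.

Lemma recursive_or n (P Q : n.-tuple nat -> bool) :
  recursive (fun v => P v : nat) -> recursive (fun v => Q v : nat) -> recursive (fun v => P v || Q v : nat).
Proof.
move=> rP rQ; apply: (@eq_recursive _ (fun v => if P v then 1 else Q v)%N).
  by move=> v; case: (P v).
exact/recursive_if/rQ/recursive_const.
Qed.

Lemma recursive_eq n (f g : n.-tuple nat -> nat) :
  recursive f -> recursive g -> recursive (fun v => f v == g v : nat)%N.
Proof.
move=> rf rg.
apply: (@eq_recursive _ (fun v => (f v <= g v) * (g v <= f v))%N).
  by move=> v; rewrite mulnb eqn_leq.
by apply: recursive_mul; apply: recursive_leq.
Qed.

Lemma recursive_exp n (f g : n.-tuple nat -> nat) :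
  recursive f -> recursive g -> recursive (fun v => f v ^ g v)%N.
Proof.
move=> rf rg.
apply: (eq_recursive _ (recursive_nat_rect (G := fun _ r v => f v * r)%N rg
  (recursive_const n 1) _)).
  by move=> v; elim: (g v) => //= k ->; rewrite expnS.
apply: recursive_mul; last exact/recursive_behead/recursive_thead.
exact: (recursive_behead (recursive_behead rf)).
Qed.

Lemma recursive_odd n (f : n.-tuple nat -> nat) :
  recursive f -> recursive (fun v => odd (f v) : nat).
Proof.
move=> rf.
apply: (eq_recursive _ (recursive_nat_rect (G := fun _ r v => 1 - r)%N rf
  (recursive_const n 0) _)).
  by move=> v; elim: (f v) => //= k ->; case: odd.
exact/recursive_sub/recursive_behead/recursive_thead/recursive_const.
Qed.

(** The least [k] satisfying [P] is the least zero of [~~ P], so a function is recursive as soon as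
    its value is the first to pass a recursive test. *)
Lemma recursive_search n (P : nat -> n.-tuple nat -> bool)
    (h : n.-tuple nat -> nat) :
  recursive (fun v : n.+1.-tuple nat => P (thead v) (behead_tuple v) : nat) ->
  (forall v, P (h v) v) -> (forall v k, (k < h v)%N -> ~~ P k v) ->
  recursive h.
Proof.
move=> rP Ph Pk; have bK x (v : n.-tuple nat) : behead_tuple [tuple of x :: v] = v.
  exact: val_inj.
apply: (recursive_min (recursive_negb rP)) => v /=; rewrite ?bK ?theadE ?Ph //.
by move=> k /Pk; rewrite bK theadE => ->.
Qed.

Lemma recursive_div n (f g : n.-tuple nat -> nat) :
  recursive f -> recursive g -> recursive (fun v => f v %/ g v)%N.
Proof.
(* The quotient is the least [q] with [f v < q.+1 * g v]; the first disjunct stops the search at 0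
   when the divisor is 0, where the quotient is 0 by convention. *)
move=> rf rg; apply: (@recursive_search _
  (fun q v => (g v == 0) || (f v < q.+1 * g v))%N).
- apply: recursive_or.
    exact/recursive_eq/recursive_const/recursive_behead.
  apply: recursive_leq; first exact/recursive_S/recursive_behead.
  exact/recursive_mul/recursive_behead/rg/recursive_S/recursive_thead.
- by move=> v; case: posnP => //= g0; rewrite -ltn_divLR.
- move=> v k; case: (posnP (g v)) => [->|g0]; first by rewrite divn0.
  by move=> kf; rewrite /= -ltn_divLR // -leqNgt.
Qed.

Lemma recursive_logn n p (f : n.-tuple nat -> nat) : prime p -> recursive f ->
  recursive (fun v => logn p (f v)).
Proof.
(* The valuation is the least [e] such that [p ^ e.+1] does not divide [f v]; divisibility is tested
   by multiplying the quotient back. At 0 the search stops at once, as [logn p 0 = 0]. *)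
move=> pp rf; apply: (@recursive_search _
  (fun e v => (f v == 0) || (f v %/ p ^ e.+1 * p ^ e.+1 != f v))%N).
- apply: recursive_or.
    exact/recursive_eq/recursive_const/recursive_behead.
  have rp : recursive (fun v : n.+1.-tuple nat => p ^ (thead v).+1)%N.
    exact/recursive_exp/recursive_S/recursive_thead/recursive_const.
  apply/recursive_negb/recursive_eq; last exact: recursive_behead.
  by apply: recursive_mul => //; apply: recursive_div => //; apply: recursive_behead.
- move=> v; case: posnP => //= f0.
  by rewrite -dvdn_eq pfactor_dvdn // ltnn.
- move=> v e; case: (posnP (f v)) => [->|f0]; first by rewrite logn0.
  by rewrite /= negbK -dvdn_eq pfactor_dvdn.
Qed.

(** * Recursive rational-valued functions *)

(* Coding a rational by a single number makes rational-valued
   primitive recursion an instance of [recursive_nat_rect]. *)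
Definition ratcode (c : nat) : rat :=
  ((logn 2 c)%:R - (logn 3 c)%:R) / (logn 5 c).+1%:R.

(** Unique factorization: the exponents of 2, 3 and 5 encode a triple in one number, and encoding
    and decoding are both recursive. *)
Lemma logn_code a b c : [/\ logn 2 (2 ^ a * 3 ^ b * 5 ^ c) = a,
  logn 3 (2 ^ a * 3 ^ b * 5 ^ c) = b & logn 5 (2 ^ a * 3 ^ b * 5 ^ c) = c].
Proof.
have e p q k : prime p -> prime q -> logn p (q ^ k) = (k * (p == q))%N.
  by move=> pp pq; rewrite lognX logn_prime //.
by split; rewrite !lognM ?muln_gt0 ?expn_gt0 // !e //; lia.
Qed.

Lemma ratcode_surj (q : rat) : exists c, ratcode c = q.
Proof.
(* The exponents are the positive and negative parts of the numerator, and the denominator minus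
   one, since [ratcode] adds one back. *)
exists (2 ^ `|Num.max (numq q) 0| * 3 ^ `|Num.min (numq q) 0| *
  5 ^ `|denq q|.-1)%N.
rewrite /ratcode; have [-> -> ->] := logn_code `|Num.max (numq q) 0|
  `|Num.min (numq q) 0| `|denq q|.-1.
rewrite prednK ?absz_gt0 ?denq_neq0 // -[RHS]divq_num_den; congr (_ / _).
  rewrite !pmulrn -rmorphB /=; congr (_%:~R); lia.
by rewrite pmulrn gez0_abs // ltW // denq_gt0.
Qed.

(** Codes need not be canonical: several codes stand for one rational, so fractions are never
    reduced. *)
Definition recursive_rat n (q : n.-tuple nat -> rat) :=
  exists2 c : n.-tuple nat -> nat, recursive c & q = ratcode \o c.

Lemma recursive_ratI n (q : n.-tuple nat -> rat) (P M D : n.-tuple nat -> nat) :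
  recursive P -> recursive M -> recursive D ->
  (forall v, q v = ((P v)%:R - (M v)%:R) / (D v).+1%:R) -> recursive_rat q.
Proof.
move=> rP rM rD qE; exists (fun v => 2 ^ P v * 3 ^ M v * 5 ^ D v)%N.
  by do 2?apply: recursive_mul; apply: recursive_exp => //; apply: recursive_const.
apply/funext => v; rewrite qE /= /ratcode.
by have [-> -> ->] := logn_code (P v) (M v) (D v).
Qed.

Lemma recursive_ratE n (q : n.-tuple nat -> rat) : recursive_rat q ->
  exists P M D, [/\ recursive P, recursive M, recursive D &
    forall v, q v = ((P v)%:R - (M v)%:R) / (D v).+1%:R].
Proof.
case=> c rc qE; exists (logn 2 \o c), (logn 3 \o c), (logn 5 \o c).
by split; try exact: recursive_logn; move=> v; rewrite qE.
Qed.

Lemma eq_recursive_rat n (q r : n.-tuple nat -> rat) :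
  q =1 r -> recursive_rat q -> recursive_rat r.
Proof. by move=> /funext ->. Qed.

Lemma recursive_rat_code n (f : n.-tuple nat -> nat) :
  recursive f -> recursive_rat (fun v => ratcode (f v)).
Proof. by exists f. Qed.

Lemma recursive_rat_const n (q : rat) :
  recursive_rat (fun _ : n.-tuple nat => q).
Proof.
by have [c <-] := ratcode_surj q; apply/recursive_rat_code/recursive_const.
Qed.

Lemma recursive_rat_comp1 n (q : nat -> rat) (f : n.-tuple nat -> nat) :
  recursive_rat (fun v : 1.-tuple nat => q (thead v)) -> recursive f ->
  recursive_rat (fun v => q (f v)).
Proof.
move=> [c rc qE] rf; exists (fun v => c [tuple f v]).
  apply: (recursive_comp1 (a := fun k => c [tuple k])) rf.
  apply: (eq_recursive _ rc) => v; congr c.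
  by apply: eq_from_tnth => i; rewrite ord1.
by apply/funext => v; move/(congr1 (@^~ [tuple f v])): qE => /= <-.
Qed.

Lemma recursive_rat_comp2 n (q : nat -> nat -> rat)
    (f g : n.-tuple nat -> nat) :
  recursive_rat (fun v : 2.-tuple nat => q (tnth v ord0) (tnth v ord_max)) ->
  recursive f -> recursive g -> recursive_rat (fun v => q (f v) (g v)).
Proof.
move=> [c rc qE] rf rg; exists (fun v => c [tuple f v; g v]).
  apply: (recursive_comp2 (a := fun k m => c [tuple k; m])) rf rg.
  apply: (eq_recursive _ rc) => v; congr c.
  apply: eq_from_tnth => -[[|[|//]] i]; rewrite /tnth /=;
    by case: v => -[|a [|b []]].
by apply/funext => v; move/(congr1 (@^~ [tuple f v; g v])): qE => /= <-.
Qed.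

Lemma recursive_rat_behead n (q : n.-tuple nat -> rat) : recursive_rat q ->
  recursive_rat (fun v : n.+1.-tuple nat => q (behead_tuple v)).
Proof.
move=> [c rc ->]; exists (fun v : n.+1.-tuple nat => c (behead_tuple v)) => //.
exact: recursive_behead.
Qed.

(** The recursion runs on codes, which is why the step [G] is assumed recursive as a function of a
    code decoded by [ratcode]; decoding then commutes with every step. *)
Lemma recursive_rat_nat_rect n (N : n.-tuple nat -> nat)
    (F : n.-tuple nat -> rat) (G : nat -> rat -> n.-tuple nat -> rat) :
  recursive N -> recursive_rat F ->
  recursive_rat (fun w : n.+2.-tuple nat =>
    G (thead w) (ratcode (thead (behead_tuple w)))
      (behead_tuple (behead_tuple w))) ->
  recursive_rat (fun v =>
    nat_rect (fun=> rat) (F v) (fun k r => G k r v) (N v)).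
Proof.
move=> rN [F' rF' ->] [G' rG' GE].
exists (fun v => nat_rect (fun=> nat) (F' v)
  (fun k r => G' [tuple of k :: r :: v]) (N v)).
  apply: (recursive_nat_rect (G := fun k r v => G' [tuple of k :: r :: v])) => //.
  apply: (eq_recursive _ rG') => w; congr G'; apply: val_inj => /=.
  by case: w => -[|a [|b s]] //= i.
apply/funext => v /=; elim: (N v) => //= k ->.
move/(congr1 (@^~ [tuple of k :: nat_rect (fun=> nat) (F' v)
  (fun k r => G' [tuple of k :: r :: v]) k :: v])): GE => /= <-.
by congr (G _ _ _); apply: val_inj.
Qed.

(** * Arithmetic and order of recursive rational-valued functions *)

Lemma recursive_rat_nat n (f : n.-tuple nat -> nat) :
  recursive f -> recursive_rat (fun v => (f v)%:R).
Proof.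
move=> rf; apply: (recursive_ratI rf (recursive_const n 0)
  (recursive_const n 0)) => v.
by rewrite subr0 divr1.
Qed.

Lemma recursive_rat_opp n (q : n.-tuple nat -> rat) :
  recursive_rat q -> recursive_rat (fun v => - q v).
Proof.
case/recursive_ratE=> [P [M [D [rP rM rD qE]]]].
by apply: (recursive_ratI rM rP rD) => v; rewrite qE -mulNr opprB.
Qed.

Lemma recursive_rat_add n (q r : n.-tuple nat -> rat) :
  recursive_rat q -> recursive_rat r -> recursive_rat (fun v => q v + r v).
Proof.
case/recursive_ratE=> [P [M [D [rP rM rD qE]]]].
case/recursive_ratE=> [P' [M' [D' [rP' rM' rD' rE]]]].
apply: (@recursive_ratI _ _ (fun v => P v * (D' v).+1 + P' v * (D v).+1)%N
  (fun v => M v * (D' v).+1 + M' v * (D v).+1)%N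
  (fun v => ((D v).+1 * (D' v).+1).-1)).
- by apply: recursive_add; apply: recursive_mul => //; apply: recursive_S.
- by apply: recursive_add; apply: recursive_mul => //; apply: recursive_S.
- by apply/recursive_pred/recursive_mul; apply: recursive_S.
- move=> v; rewrite qE rE prednK // !(natrD, natrM).
  by field; rewrite !nat1r; apply/andP; split; apply: lt0r_neq0.
Qed.

Lemma recursive_rat_mul n (q r : n.-tuple nat -> rat) :
  recursive_rat q -> recursive_rat r -> recursive_rat (fun v => q v * r v).
Proof.
case/recursive_ratE=> [P [M [D [rP rM rD qE]]]].
case/recursive_ratE=> [P' [M' [D' [rP' rM' rD' rE]]]].
apply: (@recursive_ratI _ _ (fun v => P v * P' v + M v * M' v)%N
  (fun v => P v * M' v + M v * P' v)%N
  (fun v => ((D v).+1 * (D' v).+1).-1)).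
- by apply: recursive_add; apply: recursive_mul.
- by apply: recursive_add; apply: recursive_mul.
- by apply/recursive_pred/recursive_mul; apply: recursive_S.
- move=> v; rewrite qE rE prednK // !(natrD, natrM).
  by field; rewrite !nat1r; apply/andP; split; apply: lt0r_neq0.
Qed.

Lemma recursive_rat_if n (B : n.-tuple nat -> bool)
    (q r : n.-tuple nat -> rat) :
  recursive (fun v => B v : nat) -> recursive_rat q -> recursive_rat r ->
  recursive_rat (fun v => if B v then q v else r v).
Proof.
move=> rB [c rc ->] [d rd ->]; exists (fun v => if B v then c v else d v).
  exact: recursive_if.
by apply/funext => v /=; case: ifP.
Qed.

Lemma recursive_rat_le n (q r : n.-tuple nat -> rat) :
  recursive_rat q -> recursive_rat r -> recursive (fun v => (q v <= r v)%R : nat).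
Proof.
case/recursive_ratE=> [P [M [D [rP rM rD qE]]]].
case/recursive_ratE=> [P' [M' [D' [rP' rM' rD' rE]]]].
(* Denominators are positive, so the comparison is cross-multiplied, and subtracted terms change
   sides to stay within the natural numbers. *)
apply: (@eq_recursive _ (fun v => (P v * (D' v).+1 + M' v * (D v).+1 <=
    P' v * (D v).+1 + M v * (D' v).+1)%N : nat)).
  move=> v; congr (nat_of_bool _); rewrite qE rE ler_pdivrMr // mulrAC.
  rewrite ler_pdivlMr // -(ler_nat rat) !(natrD, natrM) !mulrBl.
  by rewrite lerBrDr addrAC lerBlDr.
by apply: recursive_leq; apply: recursive_add; apply: recursive_mul => //;
  apply: recursive_S.
Qed.

Lemma recursive_rat_norm n (q : n.-tuple nat -> rat) :
  recursive_rat q -> recursive_rat (fun v => `|q v|).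
Proof.
move=> rq; apply: (@eq_recursive_rat _ (fun v => if 0 <= q v then q v else - q v)).
  by move=> v; case: ger0P.
apply: recursive_rat_if => //; last exact: recursive_rat_opp.
exact/recursive_rat_le/rq/recursive_rat_const.
Qed.

Lemma recursive_rat_min n (q r : n.-tuple nat -> rat) :
  recursive_rat q -> recursive_rat r ->
  recursive_rat (fun v => Num.min (q v) (r v)).
Proof.
move=> rq rr; apply: (@eq_recursive_rat _ (fun v => if q v <= r v then q v else r v)).
  by move=> v; rewrite minElt; case: ltgtP.
exact/recursive_rat_if/rr/rq/recursive_rat_le.
Qed.

Lemma recursive_rat_inv n (q : n.-tuple nat -> rat) :
  recursive_rat q -> recursive_rat (fun v => (q v)^-1).
Proof.
case/recursive_ratE=> [P [M [D [rP rM rD qE]]]].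
(* Subtraction is truncated, so at most one of [P v - M v] and [M v - P v] is nonzero and the sum of
   their squares is the square of the numerator. When both vanish the predecessor yields denominator
   1, and the value is 0, the inverse of 0. *)
apply: (@recursive_ratI _ _ (fun v => (P v - M v) * (D v).+1 )%N
  (fun v => (M v - P v) * (D v).+1)%N
  (fun v => ((P v - M v) * (P v - M v) + (M v - P v) * (M v - P v)).-1)%N).
- by apply: recursive_mul; [apply: recursive_sub|apply: recursive_S].
- by apply: recursive_mul; [apply: recursive_sub|apply: recursive_S].
- by apply/recursive_pred/recursive_add; apply/recursive_mul; apply: recursive_sub.
- move=> v; rewrite qE; have [PM|MP|->] := ltngtP (P v) (M v); last first.
  + by rewrite !subrr !mul0r invr0.
  + have -> : (M v - P v = 0)%N by lia.
    rewrite !mul0n addn0 prednK; last by rewrite muln_gt0 subn_gt0 MP.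
    rewrite subr0 !natrM natrB ?(ltnW MP) //.
    have h : (M v)%:R < (P v)%:R :> rat by rewrite ltr_nat.
    by field; rewrite nat1r pnatr_eq0 subr_eq0 (gt_eqF h).
  + have -> : (P v - M v = 0)%N by lia.
    rewrite !mul0n add0n prednK; last by rewrite muln_gt0 subn_gt0 PM.
    rewrite sub0r !natrM natrB ?(ltnW PM) //.
    have h : (P v)%:R < (M v)%:R :> rat by rewrite ltr_nat.
    by field; rewrite nat1r pnatr_eq0 !subr_eq0 (gt_eqF h) (lt_eqF h).
Qed.

(** * Agreement with computability by sign, numerator and denominator *)

Lemma recursive_ratP n (q : n.-tuple nat -> rat) :
  recursive_rat q <-> exists a b c : n.-tuple nat -> nat,
    [/\ recursive a, recursive b, recursive c &
      forall v, q v = (-1) ^+ a v * ((b v)%:R / (c v).+1%:R)].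
Proof.
split=> [/recursive_ratE[P [M [D [rP rM rD qE]]]]|[a [b [c [ra rb rc qE]]]]].
  (* The sum of the two truncated differences is the absolute value of the numerator. *)
  exists (fun v => (P v < M v)%N : nat),
    (fun v => (P v - M v) + (M v - P v))%N, D; split=> //.
  - by apply: recursive_leq => //; apply: recursive_S.
  - by apply: recursive_add; apply: recursive_sub.
  - move=> v; rewrite qE mulrA; congr (_ / _); case: ltnP => h.
      have -> : (P v - M v = 0)%N by lia.
      by rewrite add0n natrB ?(ltnW h) // expr1 mulN1r opprB.
    have -> : (M v - P v = 0)%N by lia.
    by rewrite addn0 natrB // expr0 mul1r.
apply: (@recursive_ratI _ _ (fun v => if odd (a v) then 0 else b v)%N
  (fun v => if odd (a v) then b v else 0)%N c) => //.
- exact/recursive_if/rb/recursive_const/recursive_odd.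
- exact/recursive_if/recursive_const/rb/recursive_odd.
- move=> v; rewrite qE -signr_odd.
  case: odd; rewrite ?expr0 ?expr1 ?mul1r ?mulN1r ?subr0 //.
  by rewrite sub0r mulNr.
Qed.

Lemma computable_ratseqP (q : nat -> rat) :
  computable_ratseq q <-> recursive_rat (fun v : 1.-tuple nat => q (thead v)).
Proof.
split=> [[a [b [c [ra rb rc qE]]]]|/recursive_ratP[a [b [c [ra rb rc qE]]]]].
  by apply/recursive_ratP; do 3!eexists; split;
    [exact: ra|exact: rb|exact: rc|move=> v; exact: qE].
have eta (F : 1.-tuple nat -> nat) : recursive F ->
    computable1 (fun k => F [tuple k]).
  move=> rF; apply: (eq_recursive _ rF) => v; congr F.
  by apply: eq_from_tnth => i; rewrite ord1.
exists (fun k => a [tuple k]), (fun k => b [tuple k]), (fun k => c [tuple k]).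
by split; [exact: eta|exact: eta|exact: eta|move=> k; exact: (qE [tuple k])].
Qed.

Lemma computable_ratseq2P (q : nat -> nat -> rat) :
  computable_ratseq2 q <->
  recursive_rat (fun v : 2.-tuple nat => q (tnth v ord0) (tnth v ord_max)).
Proof.
split=> [[a [b [c [ra rb rc qE]]]]|/recursive_ratP[a [b [c [ra rb rc qE]]]]].
  by apply/recursive_ratP; do 3!eexists; split;
    [exact: ra|exact: rb|exact: rc|move=> v; exact: qE].
have eta (F : 2.-tuple nat -> nat) : recursive F ->
    computable2 (fun k m => F [tuple k; m]).
  move=> rF; apply: (eq_recursive _ rF) => v; congr F.
  by case: v => -[|k [|m []]] // i; apply: val_inj.
exists (fun k m => a [tuple k; m]), (fun k m => b [tuple k; m]),
  (fun k m => c [tuple k; m]).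
by split; [exact: eta|exact: eta|exact: eta|move=> k m; exact: (qE [tuple k; m])].
Qed.

(** * Recursively enumerable open sets *)

Lemma exprV2_lt (R : archiRealFieldType) (e : R) : 0 < e ->
  exists n, 2^-1 ^+ n < e.
Proof.
move=> e0; exists (Num.truncn e^-1).+1; rewrite exprVn invf_plt ?posrE ?exprn_gt0 //.
apply: (lt_le_trans (truncnS_gt _)).
by rewrite -natrX ler_nat ltnW // ltn_expl.
Qed.

Lemma ratr_approx (R : realType) (x e : R) : 0 < e ->
  exists q : rat, `|x - ratr q| < e.
Proof.
move=> e0; have [q] : exists q, ratr q \in `]x - e, x + e[ by apply: rat_in_itvoo; lra.
by rewrite in_itv /= => /andP[? ?]; exists q; rewrite ltr_norml; lra.
Qed.

(** Every pair of indices is coded by some [k], so one sequence can run through a doubly indexed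
    family. *)
Lemma logn_pair i j : exists k, logn 2 k = i /\ logn 3 k = j.
Proof. by exists (2 ^ i * 3 ^ j * 5 ^ 0)%N; have [] := logn_code i j 0. Qed.

Section REOpen.
Variable R : realType.
Implicit Types (U A X Y : set R) (E F : set (R * R)).

Definition re_open1 U := exists a r : nat -> rat,
  [/\ computable_ratseq a, computable_ratseq r &
    U = [set x | exists k, `|x - ratr (a k)| < ratr (r k)]].

(** The two enumerations are interleaved: odd indices list the balls of [E], even ones those of
    [F]. *)
Lemma re_openU E F : re_open E -> re_open F -> re_open (E `|` F).
Proof.
move=> [a [r [[/computable_ratseqP ca1 /computable_ratseqP ca2]
  /computable_ratseqP cr ->]]].
move=> [b [s [[/computable_ratseqP cb1 /computable_ratseqP cb2]
  /computable_ratseqP cs ->]]].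
have mix (p q : nat -> rat) :
    recursive_rat (fun v : 1.-tuple nat => p (thead v)) ->
    recursive_rat (fun v : 1.-tuple nat => q (thead v)) ->
    computable_ratseq (fun k => if odd k then p (k %/ 2)%N else q (k %/ 2)%N).
  have half : recursive (fun v : 1.-tuple nat => thead v %/ 2)%N.
    exact/recursive_div/recursive_const/recursive_thead.
  move=> cp cq; apply/computable_ratseqP/recursive_rat_if.
  - exact/recursive_odd/recursive_thead.
  - exact: (recursive_rat_comp1 cp half).
  - exact: (recursive_rat_comp1 cq half).
exists (fun k => (if odd k then (a (k %/ 2)%N).1 else (b (k %/ 2)%N).1,
    if odd k then (a (k %/ 2)%N).2 else (b (k %/ 2)%N).2)),
  (fun k => if odd k then r (k %/ 2)%N else s (k %/ 2)%N); split.
- split.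
    exact: (mix (fun k => (a k).1) (fun k => (b k).1)).
  exact: (mix (fun k => (a k).2) (fun k => (b k).2)).
- exact: mix.
apply/seteqP; split=> x /=.
  case=> -[k _ xk]; [exists k.*2.+1|exists k.*2] => //.
    by rewrite /= odd_double /= -muln2 -addn1 divnMDl // addn0.
  by rewrite odd_double -muln2 mulnK.
move=> [k _]; case: odd => xk; [left|right]; by exists (k %/ 2)%N.
Qed.

Lemma re_open_swap E : re_open E -> re_open [set p | E (p.2, p.1)].
Proof.
move=> [a [r [[ca1 ca2] cr ->]]].
exists (fun k => ((a k).2, (a k).1)), r; split=> //.
by apply/seteqP; split=> x [k _ xk]; exists k => //;
  move: xk; rewrite /euclidean_ball /= addrC.
Qed.

Lemma le_euclidean (u v : R) : `|u| <= Num.sqrt (u ^+ 2 + v ^+ 2).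
Proof. by rewrite -sqrtr_sqr ler_wsqrtr // lerDl sqr_ge0. Qed.

Lemma euclidean_le (u v : R) : Num.sqrt (u ^+ 2 + v ^+ 2) <= `|u| + `|v|.
Proof.
rewrite -[leRHS]ger0_norm ?addr_ge0 // -sqrtr_sqr ler_wsqrtr //.
rewrite sqrrD !real_normK ?num_real // lerD2r lerDl.
by rewrite pmulrn_lge0 // mulr_ge0.
Qed.

(** A strip over an interval is the union of the discs of the same radius centred above the midpoint
    of the interval at rational heights. The exponent of 2 selects the interval, that of 3 codes the
    height. *)
Lemma re_open_fst U : re_open1 U -> re_open [set p : R * R | U p.1].
Proof.
move=> [a [r [/computable_ratseqP ca /computable_ratseqP cr ->]]].
have rec_logn p : prime p -> recursive (fun v : 1.-tuple nat => logn p (thead v)).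
  by move=> pp; apply/recursive_logn/recursive_thead.
exists (fun k => (a (logn 2 k), ratcode (logn 3 k))), (fun k => r (logn 2 k)).
split.
- split; apply/computable_ratseqP; first exact/recursive_rat_comp1/rec_logn.
  exact/recursive_rat_code/rec_logn.
- exact/computable_ratseqP/recursive_rat_comp1/rec_logn.
apply/seteqP; split=> -[x y] /=; last first.
  case=> k _; rewrite /euclidean_ball /= => xyk.
  by exists (logn 2 k); apply: le_lt_trans xyk; apply: le_euclidean.
(* The slack left by the first coordinate is the error allowed in the second, since the Euclidean
   norm is at most the sum norm. *)
case=> i; rewrite -subr_gt0 => xi; have [q] := ratr_approx y xi.
have [c <-] := ratcode_surj q => yq; have [k [ki kc]] := logn_pair i c.
exists k => //; rewrite /euclidean_ball /= ki kc.
by apply: le_lt_trans (euclidean_le _ _) _; rewrite -ltrBrDl.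
Qed.

Lemma re_open_snd U : re_open1 U -> re_open [set p : R * R | U p.2].
Proof. by move=> /re_open_fst/re_open_swap. Qed.

Lemma closed_gap A x : closed A -> ~ A x ->
  exists2 e, 0 < e & forall y, A y -> e <= `|x - y|.
Proof.
move=> cA Ax; have /nbhs_ballP[e /= e0 xe] : nbhs x (~` A).
  by apply: open_nbhs_nbhs; split=> //; apply: closed_openC.
exists e => // y Ay; rewrite leNgt; apply/negP => xy.
by apply: (xe y) Ay; rewrite -ball_normE.
Qed.

(** Starting from [u 0] gives a value at [N = 0] that still respects every lower bound common to all
    [u k]. *)
Definition min_upto (u : nat -> rat) N :=
  nat_rect (fun=> rat) (u 0) (fun k m => Num.min m (u k)) N.

Lemma min_upto_le u N k : (k < N)%N -> min_upto u N <= u k.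
Proof.
elim: N => //= N ih; rewrite ltnS leq_eqVlt => /predU1P[->|/ih kN].
  by rewrite ge_min lexx orbT.
by rewrite ge_min kN.
Qed.

Lemma le_min_upto u N t : (forall k, t <= u k) -> t <= min_upto u N.
Proof. by move=> tu; elim: N => //= N ih; rewrite le_min ih tu. Qed.

(** The points [s n k] with [k < M n] approximate [A] up to [2^-n]: each point of [A] is near one of
    them, and each of them is near [A]. The first property keeps the enumerated intervals off [A],
    the second makes them reach every point outside. *)
Lemma re_open1_setC A (s : nat -> nat -> rat) (M : nat -> nat) :
  closed A -> computable_ratseq2 s -> computable1 M ->
  (forall n x, A x ->
    exists2 k, (k < M n)%N & `|x - ratr (s n k)| <= 2^-1 ^+ n) ->
  (forall n k, exists2 x, A x & `|x - ratr (s n k)| <= 2^-1 ^+ n) ->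
  re_open1 (~` A).
Proof.
move=> cA /computable_ratseq2P cs cM As sA.
(* The exponent of 2 in [k] codes a centre and that of 3 a precision; a negative radius gives an
   empty interval. *)
pose a k := ratcode (logn 2 k).
pose u k j := `|a k - s (logn 3 k) j|.
pose r k := min_upto (u k) (M (logn 3 k)) - 2^-1 ^+ logn 3 k.
have rec_logn n p (f : n.-tuple nat -> nat) : prime p -> recursive f ->
    recursive (fun v => logn p (f v)) by move=> pp; apply: recursive_logn.
exists a, r; split.
- exact/computable_ratseqP/recursive_rat_code/rec_logn/recursive_thead.
- have rec_u n (f g : n.-tuple nat -> nat) : recursive f -> recursive g ->
      recursive_rat (fun v => u (f v) (g v)).
    move=> rf rg; apply/recursive_rat_norm/recursive_rat_add.
      exact/recursive_rat_code/rec_logn.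
    by apply/recursive_rat_opp/recursive_rat_comp2 => //; apply/rec_logn.
  apply/computable_ratseqP/recursive_rat_add.
    apply: recursive_rat_nat_rect.
    + exact/(recursive_comp1 cM)/rec_logn/recursive_thead.
    + exact: (rec_u _ _ _ (recursive_thead 0) (recursive_const 1 0)).
    + apply: recursive_rat_min.
        exact/recursive_rat_code/recursive_behead/recursive_thead.
      apply: rec_u; last exact: recursive_thead.
      exact: (recursive_behead (recursive_behead (recursive_thead 0))).
  apply/recursive_rat_opp.
  apply: (@eq_recursive_rat _ (fun v => (2 ^ logn 3 (thead v))%:R^-1)).
    by move=> v; rewrite natrX exprVn.
  apply/recursive_rat_inv/recursive_rat_nat/recursive_exp/rec_logn/recursive_thead => //.
  exact: recursive_const.
have ratr_pow n : ratr (2^-1 ^+ n) = 2^-1 ^+ n :> R.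
  by rewrite rmorphXn fmorphV rmorph_nat.
have ratr_u k j : ratr (u k j) = `|ratr (a k) - ratr (s (logn 3 k) j)| :> R.
  by rewrite /u -rmorphB ratr_norm.
apply/seteqP; split=> [x Ax|x [k xk] Ax] /=.
- have [e e0 xe] := closed_gap cA Ax.
  have [e8 e4 e20] : [/\ 0 < e / 8, 0 < e / 4 & 0 < e / 20] by split; lra.
  have [n ne] := exprV2_lt e8; have [q] := ratr_approx x e4.
  have [c <-] := ratcode_surj q => xq; have [k [kc kn]] := logn_pair c n.
  exists k; rewrite /r rmorphB /= ratr_pow /a kc kn ltrBrDr.
  (* The approximating points are at distance at least [e - e/4 - e/8 = 5e/8] from the centre, while
     the radius must exceed [e/4]. A threshold within [e/20] of [5e/9] lies between [e/2] and
     [5e/8]; it is taken rational because the minimum is formed in the rationals. *)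
  have [b [be bx]] : exists b : rat, e / 2 < ratr b /\ forall j, b <= u k j.
    have [b] := ratr_approx (5 / 9 * e) e20.
    rewrite ltr_norml => be; exists b; split; first by lra.
    move=> j; rewrite -(ler_rat R) ratr_u /a kc kn.
    have [y Ay yj] := sA n j; have := xe y Ay.
    have : `|x - y| <= `|x - ratr (ratcode c)| + `|ratr (ratcode c) - ratr (s n j)|
        + `|y - ratr (s n j)|.
      rewrite (distrC y); apply: le_trans (ler_distD (ratr (s n j)) _ _) _.
      by rewrite lerD2r ler_distD.
    lra.
  have : ratr b <= ratr (min_upto (u k) (M n)) :> R.
    by rewrite ler_rat; apply: le_min_upto.
  lra.
- have [j jM xj] := As (logn 3 k) x Ax.
  have : ratr (min_upto (u k) (M (logn 3 k))) <= ratr (u k j) :> R.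
    by rewrite ler_rat; apply: min_upto_le.
  rewrite ratr_u; have := ler_distD x (ratr (a k)) (ratr (s (logn 3 k) j)).
  move: xk; rewrite /r rmorphB /= ratr_pow (distrC x (ratr (a k))); lra.
Qed.

Lemma dense_seq_in_prod X Y (b c : nat -> R) :
  (forall k, X (b k)) -> (forall k, Y (c k)) ->
  (forall x e, X x -> 0 < e -> exists k, `|x - b k| < e) ->
  (forall y e, Y y -> 0 < e -> exists k, `|y - c k| < e) ->
  dense_seq_in (X `*` Y) (fun k => (b (logn 2 k), c (logn 3 k))).
Proof.
move=> Xb Yc Xd Yd; split=> [_ [k _ <-] /=|[x y] [/= Xx Yy] B]; first by split.
move=> /nbhs_ballP[e /= e0 Be].
have [[i xi] [j yj]] := (Xd x e Xx e0, Yd y e Yy e0).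
have [k [ki kj]] := logn_pair i j.
exists (b i, c j); split; first by exists k => //; rewrite ki kj.
by apply: Be; split; rewrite -ball_normE.
Qed.

End REOpen.

(** * Two affine contractions of the unit interval *)

(** The branch [true] reverses orientation, as the folding does on the second strip. *)
Definition ifs (K : pzRingType) (l d1 d2 : K) (b : bool) (x : K) : K :=
  if b then d2 + l * (1 - x) else d1 + l * x.

(** The image of the fixed point of the branch [false] under the word of the [n] lowest binary
    digits of [k], the lowest digit being applied first. It is defined over any field so that
    rational and real parameters share one formula. *)
Definition ifs_orbit (K : fieldType) (l d1 d2 : K) (k n : nat) : K :=
  nat_rect (fun=> K : Type) (d1 / (1 - l))
    (fun j => ifs l d1 d2 (odd (k %/ 2 ^ j))) n.

Lemma ratr_ifs_orbit (K : numFieldType) (l d1 d2 : rat) k n :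
  ratr (ifs_orbit l d1 d2 k n) = ifs_orbit (ratr l : K) (ratr d1) (ratr d2) k n.
Proof.
elim: n => [|n ih] /=; first by rewrite fmorph_div rmorphB rmorph1.
rewrite -ih /ifs; case: odd; first by rewrite rmorphD rmorphM rmorphB rmorph1.
by rewrite rmorphD rmorphM.
Qed.

Lemma recursive_rat_ifs_orbit n (l d1 d2 : n.-tuple nat -> rat)
    (k m : n.-tuple nat -> nat) :
  recursive_rat l -> recursive_rat d1 -> recursive_rat d2 ->
  recursive k -> recursive m ->
  recursive_rat (fun v => ifs_orbit (l v) (d1 v) (d2 v) (k v) (m v)).
Proof.
move=> rl rd1 rd2 rk rm.
have rsub1 (p : nat) (q : p.-tuple nat -> rat) : recursive_rat q ->
    recursive_rat (fun v => 1 - q v).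
  by move=> rq; apply/recursive_rat_add/recursive_rat_opp/rq/recursive_rat_const.
apply: (recursive_rat_nat_rect (G := fun j x v =>
  ifs (l v) (d1 v) (d2 v) (odd (k v %/ 2 ^ j)) x)) => //.
  by apply/recursive_rat_mul/recursive_rat_inv/rsub1.
have b2 (q : n.-tuple nat -> rat) : recursive_rat q ->
    recursive_rat (fun w : n.+2.-tuple nat => q (behead_tuple (behead_tuple w))).
  by move=> rq; apply: (recursive_rat_behead (recursive_rat_behead rq)).
have rx : recursive_rat (fun w : n.+2.-tuple nat =>
    ratcode (thead (behead_tuple w))).
  exact/recursive_rat_code/recursive_behead/recursive_thead.
apply: recursive_rat_if.
- apply/recursive_odd/recursive_div.
    exact: (recursive_behead (recursive_behead rk)).
  exact/recursive_exp/recursive_thead/recursive_const.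
- apply: recursive_rat_add; first exact: b2.
  by apply: recursive_rat_mul; [exact: b2|exact: rsub1].
- by apply: recursive_rat_add; [|apply: recursive_rat_mul]; rewrite ?b2 //; exact: b2.
Qed.

Section Attractor.
Variables (R : realType) (l d1 d2 : R).

(* The two images of the unit interval are disjoint subintervals of it. *)
Definition separated_ifs :=
  [/\ 0 < l, 0 <= d1, d1 + l <= 1, 0 <= d2 & d2 + l <= 1] /\ l < `|d1 - d2|.

Hypothesis sep : separated_ifs.
Local Notation g := (ifs l d1 d2).
Implicit Types (x y : R) (b c : bool).

(** The left endpoints differ by more than [l] and by at most [1 - l]. *)
Lemma separated_ifs_lt : 0 < l < 2^-1.
Proof.
case: sep => -[l0 ? ? ? ?]; rewrite l0 /=; case: (lerP d1 d2); lra.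
Qed.

Lemma ifs_01 b x : 0 <= x <= 1 -> 0 <= g b x <= 1.
Proof. by case: sep => -[? ? ? ? ?] _ ?; rewrite /ifs; case: b; nra. Qed.

(** Distinct branches have disjoint images, and each branch is affine with nonzero slope. *)
Lemma ifs_inj b c x y : 0 <= x <= 1 -> 0 <= y <= 1 -> g b x = g c y ->
  b = c /\ x = y.
Proof.
case: sep => -[l0 ? ? ? ?]; rewrite ltr_normr => /orP h /andP[? ?] /andP[? ?].
have lx : 0 <= l * x <= l by nra.
have ly : 0 <= l * y <= l by nra.
have lP a a' : l * a = l * a' -> a = a' by apply: mulfI; rewrite gt_eqF.
rewrite /ifs; case: b c => [] [] e.
- split=> //; have e1 : 1 - x = 1 - y by apply: lP; lra.
  lra.
- by exfalso; case: h; lra.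
- by exfalso; case: h; lra.
- by split=> //; apply: lP; lra.
Qed.

(** The union of the images of the unit interval under all words of length [n]. *)
Fixpoint ifs_level n : set R :=
  if n is m.+1 then g false @` ifs_level m `|` g true @` ifs_level m
  else `[0, 1]%classic.

Definition ifs_attractor := \bigcap_n ifs_level n.

Lemma ifs_levelS n b x : ifs_level n x -> ifs_level n.+1 (g b x).
Proof. by move=> ?; case: b; [right|left]; exists x. Qed.

Lemma ifs_level_01 n x : ifs_level n x -> 0 <= x <= 1.
Proof.
elim: n x => [x|n ih x]; first by rewrite /= in_itv.
by case=> -[y /ih y01 <-]; apply: ifs_01.
Qed.

Lemma ifs_attractor_01 x : ifs_attractor x -> 0 <= x <= 1.
Proof. by move=> /(_ 0%N I)/ifs_level_01. Qed.

Lemma ifs_attractor_ifs b x : ifs_attractor x -> ifs_attractor (g b x).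
Proof.
move=> Xx [|n] _; last exact/ifs_levelS/Xx.
by rewrite /= in_itv /=; apply/ifs_01/ifs_attractor_01.
Qed.

(** Each level provides a branch and a preimage of [x]; by injectivity these are the same at all
    levels, so the preimage found at level 0 lies in every level. *)
Lemma ifs_attractor_inv x : ifs_attractor x ->
  exists b y, ifs_attractor y /\ x = g b y.
Proof.
move=> Xx.
have S n : exists b y, ifs_level n y /\ x = g b y.
  by case: (Xx n.+1 I) => -[y yn <-]; [exists false|exists true]; exists y.
have [b [y [y0 xE]]] := S 0%N.
exists b, y; split=> // n _; have [c [z [zn xE']]] := S n.
have [_ ->] // : b = c /\ y = z.
by apply: ifs_inj; [exact: (ifs_level_01 y0)|exact: ifs_level_01 zn|rewrite -xE].
Qed.

Lemma closed_ifs_attractor : closed ifs_attractor.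
Proof.
have cg b : continuous (g b).
  move=> x; rewrite /ifs; case: b.
    by apply: cvgD; [exact: cvg_cst|apply: cvgMr; apply: cvgB;[exact: cvg_cst|]].
  by apply: cvgD; [exact: cvg_cst|apply: cvgMr].
apply: closed_bigI => n _; apply: compact_closed; first exact: norm_hausdorff.
elim: n => [|n ih]; first exact: segment_compact.
by apply: compactU; apply: continuous_compact => //;
  apply: continuous_subspaceT => x; apply: cg.
Qed.

Lemma ifs_fixpoint : g false (d1 / (1 - l)) = d1 / (1 - l).
Proof.
by have /andP[? ?] := separated_ifs_lt; rewrite /ifs; field; apply/eqP; lra.
Qed.

Lemma ifs_orbit_attractor k n : ifs_attractor (ifs_orbit l d1 d2 k n).
Proof.
elim: n => [|n ih]; last exact: ifs_attractor_ifs.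
have /andP[l0 l1] := separated_ifs_lt; case: sep => -[_ ? ? _ _] _.
move=> n _; elim: n => [|n ih] /=.
  by rewrite in_itv /= divr_ge0 ?ler_pdivrMr //=; lra.
by rewrite -ifs_fixpoint; left; exists (d1 / (1 - l)).
Qed.

(** Only the [n] lowest digits of [k] are read in [n] steps. *)
Lemma ifs_orbit_carry k c n :
  ifs_orbit l d1 d2 (k + c * 2 ^ n) n = ifs_orbit l d1 d2 k n.
Proof.
suff E m : (m <= n)%N ->
    ifs_orbit l d1 d2 (k + c * 2 ^ n) m = ifs_orbit l d1 d2 k m by exact: E.
elim: m => //= m ih mn; rewrite ih 1?ltnW //; congr (g _ _).
have -> : (c * 2 ^ n = 2 * (c * 2 ^ (n - m.+1)) * 2 ^ m)%N.
  by rewrite -{1}(subnK mn) expnD expnS; ring.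
by rewrite addnC divnMDl ?expn_gt0 // oddD oddM.
Qed.

(** Induction on the word length: each further branch multiplies the error by [l], which is below
    one half. *)
Lemma ifs_orbit_cover n x : ifs_attractor x ->
  exists2 k, (k < 2 ^ n)%N & `|x - ifs_orbit l d1 d2 k n| <= 2^-1 ^+ n.
Proof.
have /andP[l0 l1] := separated_ifs_lt.
elim: n x => [|n ih] x Xx.
  exists 0%N => //; have := ifs_attractor_01 Xx.
  have := ifs_attractor_01 (ifs_orbit_attractor 0 0).
  by rewrite expr0 ler_norml; lra.
have [b [y [Xy ->]]] := ifs_attractor_inv Xx; have [k kn yk] := ih y Xy.
(* The branch [b] becomes the binary digit of weight [2 ^ n], the outermost letter of the word. *)
exists (k + b * 2 ^ n)%N; first by rewrite expnS; case: b; lia.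
rewrite /= ifs_orbit_carry addnC divnMDl ?expn_gt0 // divn_small // addn0 oddb.
have -> : `|g b y - g b (ifs_orbit l d1 d2 k n)| =
    l * `|y - ifs_orbit l d1 d2 k n|.
  rewrite -[X in X * _](gtr0_norm l0) -normrM /ifs; case: b; last by congr `|_|; ring.
  by rewrite -normrN; congr `|_|; ring.
by rewrite exprS; apply: ler_pM => //; lra.
Qed.

(* One step contracts the error by at most [l + delta <= 3/4] and adds at most
   [2 delta], so an error of [8 delta] is never exceeded. *)
Lemma ifs_orbit_approx (delta l' d1' d2' : R) k n : delta <= 4^-1 ->
  `|l - l'| <= delta -> `|d1 - d1'| <= delta -> `|d2 - d2'| <= delta ->
  `|ifs_orbit l d1 d2 k n - ifs_orbit l' d1' d2' k n| <= 8 * delta.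
Proof.
move=> delta4 ll dd1 dd2; have /andP[l0 l1] := separated_ifs_lt.
have delta0 : 0 <= delta := le_trans (normr_ge0 _) ll.
have step b x x' : 0 <= x <= 1 ->
    `|g b x - ifs l' d1' d2' b x'| <= 2 * delta + 3 / 4 * `|x - x'|.
  move=> x01; have l'P : `|l'| <= 3 / 4 by move: ll; rewrite !ler_norml; lra.
  have key t t' : 0 <= t <= 1 -> `|t - t'| = `|x - x'| ->
      `|l * t - l' * t'| <= delta + 3 / 4 * `|x - x'|.
    move=> t01 <-; have -> : l * t - l' * t' = (l - l') * t + l' * (t - t') by ring.
    apply: le_trans (ler_normD _ _) _; rewrite !normrM; apply: lerD.
      rewrite -[leRHS]mulr1; apply: ler_pM => //.
      by rewrite ger0_norm; lra.
    exact: ler_wpM2r.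
  rewrite /ifs; case: b.
    have -> : d2 + l * (1 - x) - (d2' + l' * (1 - x')) =
      (d2 - d2') + (l * (1 - x) - l' * (1 - x')) by ring.
    apply: le_trans (ler_normD _ _) _.
    have e : `|1 - x - (1 - x')| = `|x - x'|.
      by rewrite distrC; congr `|_|; ring.
    by have := key (1 - x) (1 - x') _ e; lra.
  have -> : d1 + l * x - (d1' + l' * x') =
    (d1 - d1') + (l * x - l' * x') by ring.
  apply: le_trans (ler_normD _ _) _.
  by have := key x x' x01 erefl; lra.
elim: n => [|n ih]; last first.
  apply: le_trans (step _ _ _ _) _; first exact/ifs_attractor_01/ifs_orbit_attractor.
  by move: ih => /=; lra.
(* Both starting points are fixed, so their distance [t] satisfies [t <= 2 delta + 3/4 t], whence
   [t <= 8 delta]. *)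
have := step false (d1 / (1 - l)) (d1' / (1 - l'))
  (ifs_attractor_01 (ifs_orbit_attractor 0 0)).
rewrite ifs_fixpoint; have -> : ifs l' d1' d2' false (d1' / (1 - l')) = d1' / (1 - l').
  by rewrite /ifs; field; apply/eqP; move: ll; rewrite ler_norml; lra.
lra.
Qed.

(** * Computability of the attractor *)

Hypotheses (cl : computable_real l) (cd1 : computable_real d1)
  (cd2 : computable_real d2).

Lemma computable_ifs_orbit : exists2 s : nat -> nat -> nat -> rat,
  (forall n (m k j : n.-tuple nat -> nat), recursive m -> recursive k ->
    recursive j -> recursive_rat (fun v => s (m v) (k v) (j v))) &
  forall m k j, `|ifs_orbit l d1 d2 k j - ratr (s m k j)| <= 2^-1 ^+ m.
Proof.
have [q /computable_ratseqP rq ql] := cl.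
have [q1 /computable_ratseqP rq1 q1d1] := cd1.
have [q2 /computable_ratseqP rq2 q2d2] := cd2.
(* Three extra bits absorb the factor 8 of [ifs_orbit_approx] and keep the parameter error below one
   quarter. *)
exists (fun m => ifs_orbit (q (m + 3)%N) (q1 (m + 3)%N) (q2 (m + 3)%N)).
  move=> n m k j rm rk rj.
  have rm3 : recursive (fun v => m v + 3)%N.
    exact/recursive_add/recursive_const.
  by apply: recursive_rat_ifs_orbit => //;
    [exact: recursive_rat_comp1 rq rm3|exact: recursive_rat_comp1 rq1 rm3
    |exact: recursive_rat_comp1 rq2 rm3].
move=> m k j; rewrite ratr_ifs_orbit.
have -> : 2^-1 ^+ m = 8 * 2^-1 ^+ (m + 3) :> R.
  by rewrite exprD; field.
apply: ifs_orbit_approx => //; rewrite exprD.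
have : 2^-1 ^+ m <= 1 :> R by rewrite exprn_ile1 ?invr_ge0 ?invf_le1 // ler1n.
have -> : (2^-1 ^+ 3 = 8^-1 :> R) by field.
lra.
Qed.

Lemma computable_ifs_orbit_seq :
  computable_realseq (fun k => ifs_orbit l d1 d2 (logn 2 k) (logn 3 k)).
Proof.
have [s rs sP] := computable_ifs_orbit.
exists (fun k m => s m (logn 2 k) (logn 3 k)) => //.
apply/computable_ratseq2P/rs; first exact: recursive_proj.
  by apply: recursive_logn => //; apply: recursive_proj.
by apply: recursive_logn => //; apply: recursive_proj.
Qed.

Lemma ifs_orbit_dense x e : ifs_attractor x -> 0 < e ->
  exists k, `|x - ifs_orbit l d1 d2 (logn 2 k) (logn 3 k)| < e.
Proof.
move=> Xx e0; have [n ne] := exprV2_lt e0; have [i _ xi] := ifs_orbit_cover n Xx.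
by have [k [ki kn]] := logn_pair i n; exists k; rewrite ki kn; apply: le_lt_trans ne.
Qed.

Lemma re_open1_ifs_attractorC : re_open1 (~` ifs_attractor).
Proof.
have [s rs sP] := computable_ifs_orbit.
have half n : 2^-1 ^+ n = 2^-1 ^+ n.+1 + 2^-1 ^+ n.+1 :> R by rewrite exprS; field.
(* Word length and precision are both [n.+1], so that the covering error and the rounding error add
   up to [2^-n]. *)
apply: (@re_open1_setC _ _ (fun n k => s n.+1 k n.+1) (fun n => 2 ^ n.+1)%N).
- exact: closed_ifs_attractor.
- have rn : recursive (fun v : 2.-tuple nat => (tnth v ord0).+1).
    exact/recursive_S/recursive_proj.
  by apply/computable_ratseq2P/rs => //; apply: recursive_proj.
- exact/recursive_exp/recursive_S/recursive_thead/recursive_const.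
- move=> n x Xx; have [k kn xk] := ifs_orbit_cover n.+1 Xx; exists k => //.
  rewrite half; apply: le_trans (ler_distD (ifs_orbit l d1 d2 k n.+1) _ _) _.
  exact: lerD.
- move=> n k; exists (ifs_orbit l d1 d2 k n.+1); first exact: ifs_orbit_attractor.
  by rewrite half; apply: le_trans (sP _ _ _) _; rewrite lerDl exprn_ge0.
Qed.

End Attractor.

(** * The horseshoe as a product of attractors *)

Lemma computable_realV (R : realType) (x : R) :
  1 <= x -> computable_real x -> computable_real x^-1.
Proof.
(* With one extra bit the approximation is at least one half, so inversion at most doubles the
   error. *)
move=> x1 [q /computable_ratseqP rq xq]; exists (fun m => (q m.+1)^-1).
  apply/computable_ratseqP/recursive_rat_inv/(recursive_rat_comp1 rq).
  exact/recursive_S/recursive_thead.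
move=> m; rewrite fmorphV; have := xq m.+1; set r := ratr _ => xr.
have h : 2^-1 ^+ m <= 1 :> R by rewrite exprn_ile1 ?invr_ge0 ?invf_le1 // ler1n.
have r2 : 2^-1 <= r by move: xr; rewrite exprS ler_norml; lra.
have -> : x^-1 - r^-1 = (r - x) / (x * r).
  by field; apply/andP; split; apply/eqP; lra.
rewrite normrM normfV distrC ler_pdivrMr; last by rewrite normr_gt0; apply/eqP; nra.
apply: le_trans xr _; rewrite exprS mulrC ler_pM //; last by rewrite ger0_norm; nra.
Qed.

Section Horseshoe.
Variables (R : realType) (lambda mu c1 c2 d1 d2 : R) (f : R * R -> R * R).
Hypothesis hf : horseshoe_map lambda mu c1 c2 d1 d2 f.
Implicit Types (x y : R) (b : bool) (p : R * R).

Local Notation X := (ifs_attractor lambda d1 d2).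
Local Notation Y := (ifs_attractor mu^-1 c1 c2).
Local Notation gx := (ifs lambda d1 d2).
Local Notation gy := (ifs mu^-1 c1 c2).

Lemma separated_intervals (l a b : R) : 0 < l ->
  `[a, a + l] `<=` `[0, 1]%classic -> `[b, b + l] `<=` `[0, 1]%classic ->
  `[a, a + l]%classic `&` `[b, b + l]%classic = set0 -> separated_ifs l a b.
Proof.
move=> l0 sa sb ab.
have ends t : `[t, t + l] `<=` `[0, 1]%classic -> 0 <= t /\ t + l <= 1.
  move=> st; have := st t; have := st (t + l); rewrite /= !in_itv /=.
  by rewrite !lexx !lerDl (ltW l0) => /(_ isT)/andP[_ ->] /(_ isT)/andP[->].
have [[? ?] [? ?]] := (ends a sa, ends b sb); split=> //.
rewrite ltNge; apply/negP; rewrite ler_norml => abl.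
(* If the left endpoints were within [l] of each other, the larger one would lie in both
   intervals. *)
suff : set0 (Num.max a b) by [].
by rewrite -ab; split; rewrite /= in_itv /=; case: (lerP a b); lra.
Qed.

Lemma separated_x : separated_ifs lambda d1 d2.
Proof.
have [/andP[l0 _] sV1 sV2 V12] : [/\ 0 < lambda < 1,
    vertical_strip lambda d1 `<=` @unit_square R,
    vertical_strip lambda d2 `<=` @unit_square R &
    vertical_strip lambda d1 `&` vertical_strip lambda d2 = set0] by case: hf.
have i0 : `[0, 1]%classic (0 : R) by rewrite /= in_itv /= lexx ler01.
apply: separated_intervals => // [x xi|x xi|].
- by have [] := sV1 (x, 0) (conj xi i0).
- by have [] := sV2 (x, 0) (conj xi i0).
- apply/seteqP; split=> // x [xi xj].
  by rewrite -[set0 x]/(set0 (x, 0 : R)) -V12.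
Qed.

Lemma separated_y : separated_ifs mu^-1 c1 c2.
Proof.
have [m1 sH1 sH2 H12] : [/\ 1 < mu,
    horizontal_strip mu c1 `<=` @unit_square R,
    horizontal_strip mu c2 `<=` @unit_square R &
    horizontal_strip mu c1 `&` horizontal_strip mu c2 = set0] by case: hf.
have i0 : `[0, 1]%classic (0 : R) by rewrite /= in_itv /= lexx ler01.
apply: separated_intervals => [|x xi|x xi|].
- by rewrite invr_gt0; lra.
- by have [] := sH1 (0, x) (conj i0 xi).
- by have [] := sH2 (0, x) (conj i0 xi).
- apply/seteqP; split=> // x [xi xj].
  by rewrite -[set0 x]/(set0 (0 : R, x)) -H12.
Qed.

Lemma unit_squareP p : unit_square p <-> 0 <= p.1 <= 1 /\ 0 <= p.2 <= 1.
Proof. by rewrite /unit_square /= !in_itv. Qed.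

Lemma horseshoe_mapE b x y : 0 <= x <= 1 -> 0 <= y <= 1 ->
  f (x, gy b y) = (gx b x, y).
Proof.
move=> x01 y01; have m1 := hs_mu hf.
have v0 : 0 < mu^-1 by rewrite invr_gt0; lra.
have muVK t : mu * (mu^-1 * t) = t by rewrite mulVKf //; apply/eqP; lra.
have stripP c t : 0 <= t <= 1 -> c <= c + mu^-1 * t <= c + mu^-1.
  by move=> t01; rewrite lerDl lerD2l; nra.
rewrite /ifs; case: b.
  rewrite (hs_f2 hf); last by split; rewrite /= in_itv //= stripP //; lra.
  by rewrite /= addrAC subrr add0r muVK subKr.
rewrite (hs_f1 hf); last by split; rewrite /= in_itv //= stripP.
by rewrite /= addrAC subrr add0r muVK.
Qed.

(** A point that stays in the square lies in one of the two horizontal strips, and [b] records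
    which. *)
Lemma horseshoe_map_inv p : unit_square p -> unit_square (f p) ->
  exists b, p.2 = gy b (f p).2 /\ (f p).1 = gx b p.1.
Proof.
move=> Ip If; have m1 := hs_mu hf.
have muK t : mu^-1 * (mu * t) = t by rewrite mulKf //; apply/eqP; lra.
have : (horizontal_strip mu c1 `|` horizontal_strip mu c2) p.
  by rewrite -(hs_preimage hf).
case=> Hp; [exists false; rewrite (hs_f1 hf Hp)|exists true; rewrite (hs_f2 hf Hp)].
  by rewrite /ifs /= muK addrC subrK.
by rewrite /ifs /= subKr muK addrC subrK.
Qed.

Lemma horseshoe_sub : horseshoe f `<=` X `*` Y.
Proof.
move=> p [q [Iq <- fq]].
have step j : exists b, (q j).2 = gy b (q (j + 1)).2 /\
    (q (j + 1)).1 = gx b (q j).1.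
  by have := horseshoe_map_inv (Iq j); rewrite fq; apply.
(* The time is generalized before the induction: level [n.+1] at time [j] comes from level [n] at
   time [j - 1] for the abscissa and at time [j + 1] for the ordinate. *)
split=> n _ /=; move: (0 : int); elim: n => [|n ih] j.
- by have [] := Iq j.
- by have [b [_]] := step (j - 1); rewrite subrK => ->; apply: ifs_levelS.
- by have [] := Iq j.
- by have [b [-> _]] := step j; apply: ifs_levelS.
Qed.

(** The product is stable under [f], which gives the future of an orbit, and under a right inverse
    [B] of [f], which gives its past. *)
Lemma horseshoe_sup : X `*` Y `<=` horseshoe f.
Proof.
have inv (l a1 a2 : R) : separated_ifs l a1 a2 ->
    exists h : R -> bool * R, forall x, ifs_attractor l a1 a2 x ->
    ifs_attractor l a1 a2 (h x).2 /\ x = ifs l a1 a2 (h x).1 (h x).2.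
  move=> sep; suff /choice[h] : forall x, exists h : bool * R,
      ifs_attractor l a1 a2 x ->
      ifs_attractor l a1 a2 h.2 /\ x = ifs l a1 a2 h.1 h.2 by exists h.
  move=> x.
  have [/(ifs_attractor_inv sep)[b [y [? ?]]]|nx] := pselect (ifs_attractor l a1 a2 x).
    by exists (b, y).
  by exists (false, 0).
have [hx hxP] := inv _ _ _ separated_x; have [hy hyP] := inv _ _ _ separated_y.
(* Going back, the abscissa loses its first letter, and the branch with that letter is applied to
   the ordinate. *)
pose B p := ((hx p.1).2, gy (hx p.1).1 p.2).
have x01 := ifs_attractor_01 separated_x.
have y01 := ifs_attractor_01 separated_y.
have XYf p : (X `*` Y) p -> (X `*` Y) (f p).
  case: p => x y [/= Xx Yy]; have [Yh ->] := hyP y Yy.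
  rewrite horseshoe_mapE; [|exact: x01|exact: y01].
  by split=> //=; apply: ifs_attractor_ifs => //; apply: separated_x.
have XYB p : (X `*` Y) p -> (X `*` Y) (B p).
  case=> /hxP[? ?] ?; split=> //.
  by apply: ifs_attractor_ifs => //; apply: separated_y.
have fB p : (X `*` Y) p -> f (B p) = p.
  case: p => x y [/= Xx Yy]; have [Xh xE] := hxP x Xx.
  rewrite /B /= horseshoe_mapE; [|exact: x01|exact: y01].
  by rewrite -xE.
move=> p XYp.
have XYi n : (X `*` Y) (iter n f p) by elim: n => //= n /XYf.
have XYb n : (X `*` Y) (iter n B p) by elim: n => //= n /XYB.
(* [Negz n] stands for [-(n + 1)], hence the [n.+1] iterates of [B]. *)
exists (fun j => match j with Posz n => iter n f p | Negz n => iter n.+1 B p end).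
split=> // [[] n|[n|[|n]]].
- by apply/unit_squareP; have [/x01 ? /y01] := XYi n.
- by apply/unit_squareP; have [/x01 ? /y01] := XYb n.+1.
- by rewrite -PoszD addn1.
- by rewrite /= fB.
- have -> : Negz n.+1 + 1 = Negz n by rewrite !NegzE; lia.
  by rewrite [LHS]/= fB //; apply: (XYb n.+1).
Qed.

Lemma horseshoeE : horseshoe f = X `*` Y.
Proof. by apply/seteqP; split; [exact: horseshoe_sub|exact: horseshoe_sup]. Qed.

Lemma closed_horseshoe : closed (horseshoe f).
Proof.
rewrite horseshoeE (_ : _ `*` _ = fst @^-1` X `&` snd @^-1` Y) //.
apply: closedI.
  apply: closed_comp; last exact: closed_ifs_attractor.
  by move=> p _; exact: cvg_fst.
apply: closed_comp; last exact: closed_ifs_attractor.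
by move=> p _; exact: cvg_snd.
Qed.

(** The index is decoded twice: into one index per coordinate, then each of these into a word number
    and a length. *)
Lemma horseshoe_dense : dense_seq_in (horseshoe f)
  (fun k => (ifs_orbit lambda d1 d2 (logn 2 (logn 2 k)) (logn 3 (logn 2 k)),
             ifs_orbit mu^-1 c1 c2 (logn 2 (logn 3 k)) (logn 3 (logn 3 k)))).
Proof.
rewrite horseshoeE.
apply: (@dense_seq_in_prod _ _ _
  (fun k => ifs_orbit lambda d1 d2 (logn 2 k) (logn 3 k))
  (fun k => ifs_orbit mu^-1 c1 c2 (logn 2 k) (logn 3 k))).
- by move=> k; apply: (ifs_orbit_attractor separated_x _ _).
- by move=> k; apply: (ifs_orbit_attractor separated_y _ _).
- by move=> x e; exact: (ifs_orbit_dense separated_x).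
- by move=> y e; exact: (ifs_orbit_dense separated_y).
Qed.

End Horseshoe.

(** * Computability of the horseshoe *)

Lemma computable_realseq_comp (R : realType) (x : nat -> R) (u : nat -> nat) :
  computable1 u -> computable_realseq x -> computable_realseq (x \o u).
Proof.
move=> cu [q /computable_ratseq2P rq xq]; exists (fun k => q (u k)) => [|k m]; last exact: xq.
apply/computable_ratseq2P/(recursive_rat_comp2 rq); last exact: recursive_proj.
exact/(recursive_comp1 cu)/recursive_proj.
Qed.

Theorem theorem14 (R : realType) (lambda mu c1 c2 d1 d2 : R)
    (f : R * R -> R * R)
    (hf : horseshoe_map lambda mu c1 c2 d1 d2 f)
    (hlambda : computable_real lambda) (hmu : computable_real mu)
    (hc1 : computable_real c1) (hc2 : computable_real c2)
    (hd1 : computable_real d1) (hd2 : computable_real d2) :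
  [/\ horseshoe f `<=` @unit_square R,
      computable_closed (horseshoe f) &
      [set lambda; mu; c1; c2; d1; d2] `<=` @rational R ->
        computable_closed_rational (horseshoe f)].
Proof.
have sx := separated_x hf; have sy := separated_y hf.
have hnu : computable_real mu^-1 by apply: computable_realV => //; exact/ltW/hs_mu/hf.
have cH := closed_horseshoe hf.
have clogn p : prime p -> computable1 (logn p).
  by move=> pp; apply/recursive_logn/recursive_thead.
have coH : co_re_closed (horseshoe f).
  split=> //; rewrite (horseshoeE hf).
  (* The complement of a product is the union of the cylinders over the complements of its
     factors. *)
  rewrite (_ : ~` _ = [set p : R * R | (~` ifs_attractor lambda d1 d2) p.1] `|`
    [set p : R * R | (~` ifs_attractor mu^-1 c1 c2) p.2]).
    by apply: re_openU; [apply: re_open_fst|apply: re_open_snd];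
      apply: re_open1_ifs_attractorC.
  by apply/seteqP; split=> p /=; [move/not_andP|move=> /not_andP].
split.
- by move=> p [q [Iq <- _]].
- split=> //; split=> //; eexists; last exact: (horseshoe_dense hf).
  by split; apply: (@computable_realseq_comp R (fun k => ifs_orbit _ _ _ (logn 2 k) (logn 3 k)));
    [exact: clogn|exact: computable_ifs_orbit_seq
    |exact: clogn|exact: computable_ifs_orbit_seq].
move=> sub_rational; have getq x : [set lambda; mu; c1; c2; d1; d2] x ->
    exists q : rat, ratr q = x.
  by move=> /sub_rational[q _ <-]; exists q.
have [[ql lE] [qm mE]] : (exists q, ratr q = lambda) /\ (exists q, ratr q = mu).
  by split; apply: getq; rewrite /=; tauto.
have [[q1 c1E] [q2 c2E]] : (exists q, ratr q = c1) /\ (exists q, ratr q = c2).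
  by split; apply: getq; rewrite /=; tauto.
have [[p1 d1E] [p2 d2E]] : (exists q, ratr q = d1) /\ (exists q, ratr q = d2).
  by split; apply: getq; rewrite /=; tauto.
split=> //; split=> //.
(* With rational parameters the fixed points and all their images are rational, so the same dense
   sequence is already a sequence of rational points. *)
exists (fun k =>
  (ifs_orbit ql p1 p2 (logn 2 (logn 2 k)) (logn 3 (logn 2 k)),
   ifs_orbit qm^-1 q1 q2 (logn 2 (logn 3 k)) (logn 3 (logn 3 k)))).
  by split; apply/computable_ratseqP/recursive_rat_ifs_orbit;
    try exact: recursive_rat_const;
    do 2!apply: recursive_logn => //; exact: recursive_thead.
rewrite (_ : (fun k => _) = fun k =>
  (ifs_orbit lambda d1 d2 (logn 2 (logn 2 k)) (logn 3 (logn 2 k)),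
   ifs_orbit mu^-1 c1 c2 (logn 2 (logn 3 k)) (logn 3 (logn 3 k)))).
  exact: horseshoe_dense.
apply/funext => k; rewrite /ratr2 !ratr_ifs_orbit fmorphV /=.
by rewrite lE mE c1E c2E d1E d2E.
Qed.
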